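(* Let $\mathcal{P}=\bigsqcup_{n\ge1}\mathcal{P}(n)$ be a (non-symmetric) set-operad with each $\mathcal{P}(n)$ finite, and let $A$ be an associative, commutative and unital $\mathbb{Q}$-algebra. Set $\overline{\mathcal{P}}=\bigsqcup_{n\ge 2}\mathcal{P}(n)$. Then the subset $G^{\mathrm{dif}}_{\mathcal{P}}(A):=x^{\mathrm{id}}+A[[\overline{\mathcal{P}}]]$ of $A[[\mathcal{P}]]$ is a group under the composition $$(\varphi\circ\psi)(x)=\sum_{p\in\mathcal{P}}\ \sum_{q_1,\dots,q_{|p|}\in\mathcal{P}}\varphi_p\,\psi_{q_1}\cdots\psi_{q_{|p|}}\ x^{\gamma(p;q_1,\dots,q_{|p|})},$$ with unit $x^{\mathrm{id}}$. Moreover the composition respects the shifted grading $\deg(p)=|p|-1$, i.e. $\deg(\gamma(p;q_1,\dots,q_{|p|}))=\deg(p)+\sum_{i=1}^{|p|}\deg(q_i)$ for all $p,q_1,\dots,q_{|p|}\in\mathcal{P}$.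
   Context: A (non-symmetric) set-operad is a collection of finite sets $\mathcal{P}(n)$, $n\ge1$, with $\mathcal{P}=\bigsqcup_{n\ge1}\mathcal{P}(n)$, together with composition maps $\gamma:\mathcal{P}(n)\times\mathcal{P}(m_1)\times\dots\times\mathcal{P}(m_n)\to\mathcal{P}(m_1+\dots+m_n)$, $(p;q_1,\dots,q_n)\mapsto\gamma(p;q_1,\dots,q_n)$, satisfying the associativity condition $$\gamma(\gamma(p;q_1,\dots,q_n);u^1_1,\dots,u^1_{m_1},\dots,u^n_1,\dots,u^n_{m_n})=\gamma(p;\gamma(q_1;u^1_1,\dots,u^1_{m_1}),\dots,\gamma(q_n;u^n_1,\dots,u^n_{m_n})),$$ and an element $\mathrm{id}\in\mathcal{P}(1)$ with $\gamma(\mathrm{id};q)=q$ and $\gamma(p;\mathrm{id},\dots,\mathrm{id})=p$. For $p\in\mathcal{P}(n)$ its order is $|p|=n$. $A[[\mathcal{P}]]$ is the $A$-module of formal series $\varphi(x)=\sum_{p\in\mathcal{P}}\varphi_p\,x^p$ with $\varphi_p\in A$ (i.e. families $(\varphi_p)_{p\in\mathcal{P}}$; $x^p$ is just a symbol), and $A[[\overline{\mathcal{P}}]]$ is the subspace of series supported on $\overline{\mathcal{P}}$. *)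

(* Defs.v *)
From mathcomp Require Import all_boot all_order all_algebra.
From mathcomp Require Import boolp classical_sets functions cardinality fsbigop.

Set Implicit Arguments.
Unset Strict Implicit.
Unset Printing Implicit Defensive.

Import Order.TTheory GRing.Theory Num.Theory.

Local Open Scope classical_set_scope.
Local Open Scope ring_scope.

(* [ops n] is P(n). The collection is indexed by n >= 1, which is encoded by
   [ops 0] being empty. The two sides of each law have arities that are equal
   but not convertible, so the laws are equalities in the disjoint union
   {n & ops n}. In [opgammaA] the arguments u i j are listed in lexicographic
   order: [tagnat.sig1 t] and [tagnat.sig2 t] are the block i and the position
   j within this block of the index t : 'I_(\sum_i m i). *)
Record operad := Operad {
  ops :> nat -> finType;
  ops0 : ops 0%N -> False;
  opgamma : forall (n : nat) (m : 'I_n -> nat),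
    ops n -> (forall i, ops (m i)) -> ops (\sum_(i < n) m i)%N;
  opid : ops 1%N;
  opgammaA : forall (n : nat) (m : 'I_n -> nat) (k : forall i, 'I_(m i) -> nat)
    (p : ops n) (q : forall i, ops (m i)) (u : forall i j, ops (k i j)),
    Tagged ops (opgamma (opgamma p q)
                        (fun t => u (tagnat.sig1 t) (tagnat.sig2 t)))
    = Tagged ops (opgamma p (fun i => opgamma (q i) (u i)));
  opgamma1p : forall (m : nat) (q : ops m),
    Tagged ops (opgamma opid (fun _ => q)) = Tagged ops q;
  opgammap1 : forall (n : nat) (p : ops n),
    Tagged ops (opgamma p (fun _ => opid)) = Tagged ops p
}.

Notation elements P := {n : nat & ops P n}.

Section Elements.
Variable P : operad.

Definition op_order (p : elements P) : nat := tag p.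

Definition id_elt : elements P := Tagged (ops P) (opid P).

Definition gamma (p : elements P) (q : 'I_(op_order p) -> elements P) :
    elements P :=
  Tagged (ops P) (opgamma (tagged p) (fun i => tagged (q i))).

Definition op_deg (p : elements P) : int := (op_order p)%:Z - 1.

End Elements.

(* The A-module structure is the pointwise one of the library on functions. *)
Notation series P A := (elements P -> A).

Section Series.
Variables (P : operad) (A : comPzRingType).
Implicit Types phi psi : series P A.

Definition monomial (p : elements P) : series P A := fun r => (r == p)%:R.

Definition series_bar : set (series P A) :=
  [set phi | forall p, phi p != 0 -> (2 <= op_order p)%N].

Definition Gdif : set (series P A) :=
  [set monomial (id_elt P) + phi | phi in series_bar].

(* The coefficient at r collects the terms with gamma(p; q_1, ..., q_|p|) = r.
   The operator \sum_(_ \in _) is a sum over the support of the summand, which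
   is finite here by [finite_gamma_args] and [finite_gamma_ops]. *)
Definition series_comp phi psi : series P A := fun r =>
  \sum_(p \in [set: elements P])
    \sum_(q \in [set q : {ffun 'I_(op_order p) -> elements P} | gamma q = r])
      phi p * \prod_(i < op_order p) psi (q i).

End Series.

Arguments monomial {P} A p.
Arguments series_bar : clear implicits.
Arguments Gdif : clear implicits.

Definition is_group (T : Type) (G : set T) (mul : T -> T -> T) (one : T) :
    Prop :=
  [/\ forall x y, G x -> G y -> G (mul x y),
      forall x y z, G x -> G y -> G z -> mul x (mul y z) = mul (mul x y) z,
      G one,
      forall x, G x -> mul one x = x /\ mul x one = x
    & forall x, G x -> exists y, [/\ G y, mul y x = one & mul x y = one]].

Section Finiteness.
Variable P : operad.

Lemma order_gt0 (p : elements P) : (0 < op_order p)%N.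
Proof. by case: p => -[|n] x //; case: (ops0 x). Qed.

Lemma order_arg_le (p : elements P) (q : 'I_(op_order p) -> elements P)
  (i : 'I_(op_order p)) : (op_order (q i) <= op_order (gamma q))%N.
Proof. by rewrite /op_order /= (bigD1 i) //= leq_addr. Qed.

Lemma order_op_le (p : elements P) (q : 'I_(op_order p) -> elements P) :
  (op_order p <= op_order (gamma q))%N.
Proof.
rewrite -{1}[op_order p]card_ord -sum1_card /op_order /=.
by apply: leq_sum => i _; exact: order_gt0.
Qed.

Lemma finite_gamma_args (p r : elements P) :
  finite_set [set q : {ffun 'I_(op_order p) -> elements P} | gamma q = r].
Proof.
pose B := {k : 'I_(op_order r).+1 & P k}.
pose incl (b : B) : elements P := Tagged (ops P) (tagged b).
pose F (g : {ffun 'I_(op_order p) -> B}) :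
  {ffun 'I_(op_order p) -> elements P} := [ffun i => incl (g i)].
have finF : finite_set (range F).
  by apply: finite_image; exact: (@finite_finset {ffun 'I_(op_order p) -> B}).
apply: sub_finite_set finF => q /= qr.
have le_q i : (op_order (q i) < (op_order r).+1)%N.
  by rewrite ltnS -qr order_arg_le.
exists [ffun i => Tagged (fun k : 'I_(op_order r).+1 => P k)
          (tagged (q i) : P (Ordinal (le_q i)))] => //.
by apply/ffunP => i; rewrite !ffunE /incl /=; case: (q i).
Qed.

Lemma finite_gamma_ops (r : elements P) :
  finite_set [set p : elements P |
    exists q : {ffun 'I_(op_order p) -> elements P}, gamma q = r].
Proof.
pose B := {k : 'I_(op_order r).+1 & P k}.
pose incl (b : B) : elements P := Tagged (ops P) (tagged b).
have fin_incl : finite_set (range incl).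
  by apply: finite_image; exact: (@finite_finset B).
apply: sub_finite_set fin_incl => p [q qr].
have le_p : (op_order p < (op_order r).+1)%N by rewrite ltnS -qr order_op_le.
exists (Tagged (fun k : 'I_(op_order r).+1 => P k)
          (tagged p : P (Ordinal le_p))) => //.
by rewrite /incl /=; case: (p).
Qed.

End Finiteness.

(* Main.v *)
(** The coefficient of [x^r] in a composite only involves operations of order at
   most [|r|], so it is a sum over finite types. Associativity of the
   composition is then operadic associativity combined with expanding a product
   over the blocks [i] of sums over the arguments of the block [i] into a single
   sum over the arguments of the composite operation. For [phi = e + f] with
   [e = x^id] and [f] supported in order at least 2, a right inverse is a fixed
   point of [psi |-> e - f o psi]; this map is a contraction for the filtration
   by the order, because [gamma(p; q_1, ..., q_n)] has order greater than each
   [q_i] when [n >= 2]. Right inverses in a monoid are two-sided. *)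
Require Import Defs.
From mathcomp Require Import all_boot all_order all_algebra.
From mathcomp Require Import boolp classical_sets functions cardinality fsbigop.

Set Implicit Arguments.
Unset Strict Implicit.
Unset Printing Implicit Defensive.

Import GRing.Theory.
Local Open Scope ring_scope.

(** * Products and sums over consecutive blocks of indices *)

Lemma prod_tagnat (A : comPzSemiRingType) (n : nat) (m : 'I_n -> nat)
    (F : 'I_(\sum_(i < n) m i) -> A) :
  \prod_t F t = \prod_(i < n) \prod_(j < m i) F (tagnat.Rank i j).
Proof.
rewrite (reindex (@tagnat.rank n m)); last exact: tagnat.rank_bij_on.
under eq_bigr => t _ do rewrite tagnat.rankE.
by rewrite (sig_big_dep xpredT (fun _ => xpredT)
  (fun i j => F (tagnat.Rank i j))).
Qed.

(** A family with one function on each block is the same as a single function on the concatenation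
    of the blocks, so distributivity yields one sum. *)
Lemma prod_sum_tagnat (A : comPzSemiRingType) (B : finType) (n : nat)
    (m : 'I_n -> nat) (G : forall i, {ffun 'I_(m i) -> B} -> A) :
  \prod_(i < n) \sum_u G i u =
  \sum_(v : {ffun 'I_(\sum_(i < n) m i) -> B})
    \prod_(i < n) G i [ffun j => v (tagnat.Rank i j)].
Proof.
pose T i : finType := {ffun 'I_(m i) -> B}.
transitivity (\sum_(t : fprod T) \prod_(i < n) G i (t i)).
  pose H i : {ffun T i -> A} := [ffun u => G i u].
  transitivity (\sum_(t : fprod T) \prod_(i in 'I_n) H i (t i)); last first.
    by apply: eq_bigr => t _; apply: eq_bigr => i _; rewrite ffunE.
  rewrite big_fprod.
  (* Dependent choices have become functions into a tagged union; the default [0] of [untag] is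
     never taken, since [g] has tag [i]. *)
  rewrite (eq_bigr (fun i => \sum_(g in tagged_with T i) untag 0 (H i) g)).
    by rewrite bigA_distr_big_dep; apply: eq_bigl => g.
  move=> i _; rewrite -(big_tag (fun i => H i)).
  by apply: eq_bigr => u _; rewrite ffunE.
rewrite (reindex (fun v : {ffun 'I_(\sum_(i < n) m i) -> B} =>
  [fprod i => [ffun j => v (tagnat.Rank i j)] : T i])); last first.
  apply: onW_bij.
  exists (fun t : fprod T => [ffun s => t (tagnat.sig1 s) (tagnat.sig2 s)]).
    by move=> v; apply/ffunP => s; rewrite ffunE fprodE ffunE tagnat.sig2K.
  move=> t; apply/fprodP => i; rewrite fprodE; apply/ffunP => j; rewrite !ffunE.
  have := tagnat.Rank1K j; have := tagnat.rankK (Tagged (fun i => 'I_(m i)) j).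
  by rewrite /tagnat.sig2 /tagnat.sig1 /tagnat.Rank => ->.
by apply: eq_bigr => v _; apply: eq_bigr => i _; rewrite fprodE.
Qed.

(** * Operations of bounded order *)

Section BoundedOrder.
Variable P : operad.

(** A finite type, through which sums of finite support over [elements P] become ordinary big
    sums. *)
Definition below (N : nat) := {k : 'I_N.+1 & ops P k}.

Definition below_elt N (b : below N) : elements P := Tagged (ops P) (tagged b).

Lemma below_elt_inj N : injective (@below_elt N).
Proof.
(* An element is rebuilt from its image with an arbitrary proof of the bound, so that equal images
   can be rewritten. *)
have eltK (b : below N) (bN : (op_order (below_elt b) < N.+1)%N) :
    b = Tagged (fun k : 'I_N.+1 => ops P k)
      (tagged (below_elt b) : ops P (Ordinal bN)).
  by case: b bN => -[i iN] x /= bN; rewrite (bool_irrelevance bN iN).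
move=> b c bc; move: (eltK b) (eltK c); rewrite bc => bE cE.
have cN : (op_order (below_elt c) < N.+1)%N by exact: ltn_ord.
by rewrite (bE cN) -cE.
Qed.

Lemma below_eltP N (p : elements P) :
  (op_order p <= N)%N -> exists b : below N, below_elt b = p.
Proof.
case: p => k x /=; rewrite -ltnS => kN.
by exists (Tagged (fun k : 'I_N.+1 => ops P k) (x : ops P (Ordinal kN))).
Qed.

Lemma order_below N (b : below N) : (op_order (below_elt b) <= N)%N.
Proof. by rewrite -ltnS; exact: ltn_ord. Qed.

Definition below_args N n (q : {ffun 'I_n -> below N}) :
  {ffun 'I_n -> elements P} := [ffun i => below_elt (q i)].

Lemma below_argsE N n (q : {ffun 'I_n -> below N}) :
  below_args q = (fun i => below_elt (q i)) :> ('I_n -> elements P).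
Proof. by apply/funext => i; rewrite ffunE. Qed.

Lemma below_args_inj N n : injective (@below_args N n).
Proof.
move=> q q' /ffunP e; apply/ffunP => i; apply: below_elt_inj.
by have := e i; rewrite !ffunE.
Qed.

Lemma below_argsP N n (q : 'I_n -> elements P) :
  (forall i, op_order (q i) <= N)%N ->
  exists b : {ffun 'I_n -> below N}, (fun i => below_elt (b i)) = q.
Proof.
move=> qN; have [f fE] := choice (fun i => below_eltP (qN i)).
by exists [ffun i => f i]; apply/funext => i; rewrite ffunE.
Qed.

(** * Operad laws and grading in the disjoint union *)

Lemma gammaA (p : elements P) (q : 'I_(op_order p) -> elements P)
    (v : 'I_(op_order (gamma q)) -> elements P) :
  gamma v = gamma (fun i => gamma (fun j => v (tagnat.Rank i j))).
Proof.
(* The flat family [v] is first put into the doubly indexed form required by [opgammaA]. *)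
transitivity (gamma (fun t : 'I_(op_order (gamma q)) =>
    v (tagnat.Rank (tagnat.sig1 t) (tagnat.sig2 t)))).
  by congr gamma; apply/funext => t; rewrite tagnat.sig2K.
exact: (opgammaA (tagged p) (fun i => tagged (q i))
  (fun i j => tagged (v (tagnat.Rank i j)))).
Qed.

Lemma gamma1p (q : 'I_(op_order (id_elt P)) -> elements P) :
  gamma q = q ord0.
Proof.
have -> : q = fun=> q ord0 by apply/funext => i; rewrite ord1.
by rewrite /gamma (opgamma1p (tagged (q ord0))); case: (q ord0).
Qed.

Lemma gammap1 (p : elements P) :
  gamma (fun _ : 'I_(op_order p) => id_elt P) = p.
Proof. by rewrite /gamma (opgammap1 (tagged p)); case: p. Qed.

Lemma gamma_deg (p : elements P) (q : 'I_(op_order p) -> elements P) :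
  op_deg (gamma q) = op_deg p + \sum_(i < op_order p) op_deg (q i).
Proof.
rewrite /op_deg sumrB sumr_const card_ord -!natz natr_sum.
under [in RHS]eq_bigr do rewrite -natz.
by rewrite [RHS]addrC addrA subrK.
Qed.

(** Some other argument contributes a positive order. This strictness makes $\psi\mapsto
    e-f\circ\psi$ contracting. *)
Lemma order_arg_lt (p : elements P) (q : 'I_(op_order p) -> elements P)
    (i : 'I_(op_order p)) :
  (2 <= op_order p)%N -> (op_order (q i) < op_order (gamma q))%N.
Proof.
move=> p2; rewrite {2}/op_order /= (bigD1 i) //= -addn1 leq_add2l.
have [j ji] : exists j : 'I_(op_order p), j != i.
  case: (eqVneq i (Ordinal p2)) => [->|]; last by rewrite eq_sym; exists (Ordinal p2).
  by exists (Ordinal (ltnW p2)).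
by rewrite (bigD1 j) //= (leq_trans (Defs.order_gt0 (q j))) ?leq_addr.
Qed.

End BoundedOrder.

(** * Coefficients of a composite as finite sums *)

Section Composition.
Variables (P : operad) (A : comPzRingType).
Implicit Types (phi psi chi : series P A) (r : elements P).

(** Collapse of a Kronecker delta; when [r] is out of range no term matches, hence the hypothesis on
    [F]. *)
Lemma sum_below_eq N (F : elements P -> A) r :
  ((N < op_order r)%N -> F r = 0) ->
  \sum_(b : below P N) (r == below_elt b)%:R * F (below_elt b) = F r.
Proof.
have [/below_eltP [b <-] _|rN /(_ isT) ->] := leqP (op_order r) N.
  rewrite (bigD1 b) //= eqxx mul1r big1 ?addr0 // => c cb.
  by rewrite (inj_eq (@below_elt_inj _ _)) eq_sym (negbTE cb) mul0r.
rewrite big1 // => b _; case: eqP => [rb|_]; last by rewrite mul0r.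
by move: rN; rewrite rb ltnNge order_below.
Qed.

Lemma sum_below N (F : elements P -> A) :
  (forall p, (N < op_order p)%N -> F p = 0) ->
  \sum_(p \in [set: elements P]) F p = \sum_(b : below P N) F (below_elt b).
Proof.
move=> F0; rewrite (@fsbigE _ _ _ _ _ (map (@below_elt P N) (index_enum _))) //.
- by rewrite big_map; apply: eq_bigl => b; rewrite in_setT.
- by rewrite map_inj_uniq ?index_enum_uniq //; exact: below_elt_inj.
- move=> p _ /mapP pN; apply: F0; rewrite ltnNge; apply/negP => /below_eltP.
  by move=> [b bp]; apply: pN; exists b; rewrite ?mem_index_enum.
Qed.

(** Neither an operation nor its arguments exceed the order of the composite. The bound [N] is left
    free so that coefficients at different [r] share one index type. *)
Lemma series_compE N phi psi r : (op_order r <= N)%N ->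
  series_comp phi psi r =
  \sum_(p : below P N)
    \sum_(q : {ffun 'I_(op_order (below_elt p)) -> below P N})
      (gamma (fun i => below_elt (q i)) == r)%:R *
      (phi (below_elt p) * \prod_i psi (below_elt (q i))).
Proof.
move=> rN; rewrite /series_comp (@sum_below N) => [|p Np]; last first.
  apply: fsbig1 => q /= qr; move: Np.
  by rewrite ltnNge (leq_trans (order_op_le q)) ?qr.
apply: eq_bigr => p _.
rewrite (@fsbigE _ _ _ _ _ (map (@below_args P N _)
  [seq q : {ffun 'I_(op_order (below_elt p)) -> below P N} <- index_enum _
     | gamma (fun i => below_elt (q i)) == r])).
- rewrite big_map big_filter_cond /= [LHS]big_mkcond /=.
  apply: eq_bigr => q _; rewrite below_argsE.
  case: (eqVneq _ r) => [qr|_] /=; last by rewrite mul0r.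
  by rewrite mem_set ?mul1r //= below_argsE.
- rewrite map_inj_uniq ?filter_uniq ?index_enum_uniq //.
  exact: below_args_inj.
- by move=> _ /= /mapP [q + ->]; rewrite mem_filter below_argsE => /andP [/eqP].
- move=> q /= qr /mapP qN; exfalso; apply: qN.
  have [i|b bq] := @below_argsP P N _ q.
    by rewrite (leq_trans _ rN) // -qr order_arg_le.
  exists b; last by apply/ffunP => i; rewrite ffunE -bq.
  by rewrite mem_filter mem_index_enum bq qr eqxx.
Qed.

(** The delta collapse for tuples, which eliminates the intermediate values of a nested
    composite. *)
Lemma sum_below_args N n (g : 'I_n -> elements P)
    (F : ('I_n -> elements P) -> A) :
  ((exists i, N < op_order (g i))%N -> F g = 0) ->
  \sum_(s : {ffun 'I_n -> below P N})
    F (fun i => below_elt (s i)) * \prod_i (g i == below_elt (s i))%:R = F g.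
Proof.
move=> F0; have [gN|] := pselect (forall i, op_order (g i) <= N)%N.
  have [s sg] := below_argsP gN.
  rewrite (bigD1 s) //= sg big1 => [|i _]; last by rewrite -sg eqxx.
  rewrite mulr1 big1 ?addr0 // => s' /eqP ss'.
  have [gs'|/forallP] := boolP [forall i, g i == below_elt (s' i)].
    case: ss'; apply/ffunP => i; apply: below_elt_inj.
    by rewrite -(eqP (forallP gs' i)) -sg.
  by move=> /forallP/forallPn [i gi]; rewrite (bigD1 i) //= (negbTE gi) mul0r mulr0.
move=> /existsNP [i /negP]; rewrite -ltnNge => gi.
rewrite F0; last by exists i.
rewrite big1 // => s _; rewrite (bigD1 i) //=.
case: eqP => [gs|_]; last by rewrite mul0r mulr0.
by move: gi; rewrite gs ltnNge order_below.
Qed.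

(** * Monoid laws of the composition *)

Lemma series_compA phi psi chi :
  series_comp phi (series_comp psi chi) = series_comp (series_comp phi psi) chi.
Proof.
apply/funext => r; pose N := op_order r.
pose rhs (p : below P N) (q : {ffun 'I_(op_order (below_elt p)) -> below P N}) :=
  phi (below_elt p) * \prod_i psi (below_elt (q i)) *
  \sum_(v : {ffun 'I_(op_order (gamma (fun i => below_elt (q i)))) -> below P N})
    (gamma (fun t => below_elt (v t)) == r)%:R * \prod_t chi (below_elt (v t)).
(* Common form of both sides: a sum over [p], its arguments [q] and the arguments [v] of
   $\gamma(p;q)$. *)
transitivity (\sum_p \sum_q rhs p q).
  rewrite (series_compE _ _ (leqnn N)); apply: eq_bigr => p _.
  under eq_bigr => s _.
    under eq_bigr => i _.
      rewrite (series_compE _ _ (order_below (s i))).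
      over.
    rewrite bigA_distr_bigA /= mulrCA mulr_sumr.
    over.
  under eq_bigr do rewrite mulr_sumr.
  rewrite exchange_big /=; apply: eq_bigr => q _.
  rewrite /rhs -mulrA.
  under eq_bigr => s _.
    rewrite prod_sum_tagnat mulr_sumr mulr_sumr.
    over.
  rewrite exchange_big /= !mulr_sumr; apply: eq_bigr => v _.
  pose g i := gamma (fun j : 'I_(op_order (below_elt (q i))) =>
    below_elt (v (tagnat.Rank i j))).
  pose c := phi (below_elt p) * (\prod_i psi (below_elt (q i)) *
    \prod_t chi (below_elt (v t))).
  (* For fixed [q] and [v], each intermediate [s i] is forced to be [g i], the composite of [q i]
     with the [i]-th block of [v]. *)
  transitivity (\sum_(s : {ffun 'I_(op_order (below_elt p)) -> below P N})
      (gamma (fun i => below_elt (s i)) == r)%:R *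
      \prod_i (g i == below_elt (s i))%:R * c).
    apply: eq_bigr => s _; rewrite !big_split /= /c prod_tagnat.
    have -> : \prod_i (g i == below_elt (s i))%:R = \prod_i (gamma
        (fun j : 'I_(op_order (below_elt (q i))) =>
          below_elt ([ffun j => v (tagnat.Rank i j)] j)) == below_elt (s i))%:R :> A.
      by apply: eq_bigr => i _; congr (_ == _)%:R; congr gamma;
        apply/funext => j; rewrite ffunE.
    under [X in _ * (_ * (_ * (_ * X)))]eq_bigr => i _ do
      under eq_bigr => j _ do rewrite ffunE.
    by rewrite -!mulrA mulrCA; congr (_ * _); rewrite mulrCA.
  rewrite -mulr_suml (sum_below_args (F := fun g => (gamma g == r)%:R)).
    rewrite (@gammaA P (below_elt p) (fun i => below_elt (q i))
      (fun t => below_elt (v t))) /c mulrCA; congr (_ * _).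
    by rewrite mulrCA.
  move=> [i]; rewrite ltnNge; case: eqP => // gr.
  by rewrite /N -gr order_arg_le.
rewrite (series_compE _ _ (leqnn N)).
pose F y : A := \sum_(v : {ffun 'I_(op_order y) -> below P N})
  (gamma (fun t => below_elt (v t)) == r)%:R * \prod_t chi (below_elt (v t)).
(* Here the single intermediate operation [b] is forced to be $\gamma(p;q)$. *)
transitivity (\sum_(b : below P N) series_comp phi psi (below_elt b) * F (below_elt b)).
  under [RHS]eq_bigr => b _.
    rewrite (series_compE _ _ (order_below b)) mulr_suml.
    under eq_bigr do rewrite mulr_suml.
    over.
  rewrite exchange_big /=; apply: eq_bigr => p _.
  rewrite exchange_big /=; apply: eq_bigr => q _.
  under eq_bigr do rewrite -mulrA mulrCA.
  rewrite -mulr_sumr (@sum_below_eq N F) // => rN.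
  rewrite /F big1 // => v _; case: eqP => [vr|]; rewrite ?mul0r //.
  by have := order_op_le (fun t => below_elt (v t)); rewrite vr leqNgt rN.
apply: eq_bigr => b _; rewrite mulr_sumr; apply: eq_bigr => v _.
by rewrite mulrCA.
Qed.

Lemma series_comp1l phi : series_comp (monomial A (id_elt P)) phi = phi.
Proof.
apply/funext => r; pose N := op_order r.
rewrite (series_compE _ _ (leqnn N)).
pose F p : A := \sum_(q : {ffun 'I_(op_order p) -> below P N})
  (gamma (fun i => below_elt (q i)) == r)%:R * \prod_i phi (below_elt (q i)).
transitivity (\sum_(p : below P N) (id_elt P == below_elt p)%:R * F (below_elt p)).
  apply: eq_bigr => p _; rewrite mulr_sumr; apply: eq_bigr => q _.
  by rewrite mulrCA /monomial eq_sym.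
(* The identity lies within the bound [N] because every operation has positive order. *)
rewrite sum_below_eq => [|]; last first.
  by rewrite ltnNge (Defs.order_gt0 r : (op_order (id_elt P) <= N)%N).
rewrite /F (reindex (fun b : below P N => [ffun _ : 'I_1 => b])) /=; last first.
  apply: onW_bij; exists (fun q : {ffun 'I_1 -> below P N} => q ord0) => [b|q].
    by rewrite ffunE.
  by apply/ffunP => i; rewrite ffunE [i]ord1.
rewrite -[RHS](@sum_below_eq N) ?ltnn //; apply: eq_bigr => b _.
rewrite (@gamma1p P (fun i => below_elt ([ffun=> b] i))) big_ord1 !ffunE.
by rewrite eq_sym.
Qed.

Lemma series_comp1r phi : series_comp phi (monomial A (id_elt P)) = phi.
Proof.
apply/funext => r; pose N := op_order r.
rewrite (series_compE _ _ (leqnn N)) -[RHS](@sum_below_eq N) ?ltnn //.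
apply: eq_bigr => p _.
transitivity (\sum_(q : {ffun 'I_(op_order (below_elt p)) -> below P N})
    (gamma (fun i => below_elt (q i)) == r)%:R *
    \prod_i (id_elt P == below_elt (q i))%:R * phi (below_elt p)).
  apply: eq_bigr => q _; rewrite -mulrA; congr (_ * _); rewrite mulrC.
  by congr (_ * _); apply: eq_bigr => i _; rewrite /monomial eq_sym.
rewrite -mulr_suml (sum_below_args (F := fun g => (gamma g == r)%:R)
  (g := fun=> id_elt P)).
  by rewrite gammap1 eq_sym.
by move=> [i]; rewrite ltnNge (Defs.order_gt0 r : (op_order (id_elt P) <= N)%N).
Qed.

Lemma eq_series_comp phi psi phi' psi' r :
  (forall (p : elements P) (q : 'I_(op_order p) -> elements P), gamma q = r ->
    phi p * \prod_i psi (q i) = phi' p * \prod_i psi' (q i)) ->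
  series_comp phi psi r = series_comp phi' psi' r.
Proof.
move=> eqc; apply: eq_fsbigr => p _; apply: eq_fsbigr => q; rewrite inE => qr.
exact: eqc.
Qed.

Lemma series_compDl phi phi' psi :
  series_comp (phi + phi') psi = series_comp phi psi + series_comp phi' psi.
Proof.
apply/funext => r; rewrite !fctE !(series_compE _ _ (leqnn _)) -big_split /=.
apply: eq_bigr => p _; rewrite -big_split /=; apply: eq_bigr => q _.
by rewrite -mulrDr -mulrDl.
Qed.

(** * Closure of [Gdif] under composition and inverses *)

Lemma GdifP phi : Gdif P A phi <->
  forall p, (op_order p < 2)%N -> phi p = monomial A (id_elt P) p.
Proof.
split=> [[f f_bar <-] p p1|phi1].
  rewrite fctE; have [->|/f_bar] := eqVneq (f p) 0; first by rewrite addr0.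
  by rewrite leqNgt p1.
exists (phi - monomial A (id_elt P)); last by rewrite addrC subrK.
move=> p; rewrite leqNgt; apply: contra => p1.
by rewrite !fctE phi1 // subrr.
Qed.

Lemma Gdif1 : Gdif P A (monomial A (id_elt P)).
Proof. by apply/GdifP. Qed.

Lemma Gdif_comp phi psi :
  Gdif P A phi -> Gdif P A psi -> Gdif P A (series_comp phi psi).
Proof.
move=> /GdifP phi1 /GdifP psi1; apply/GdifP => r r1.
(* Writing $e=e\circ e$ allows a termwise comparison: in order below 2 only coefficients of order
   below 2 enter. *)
rewrite -[in RHS](series_comp1l (monomial A (id_elt P))).
apply: eq_series_comp => p q qr; rewrite phi1; last first.
  by rewrite (leq_ltn_trans (order_op_le q)) ?qr.
congr (_ * _); apply: eq_bigr => i _; rewrite psi1 //.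
by rewrite (leq_ltn_trans (order_arg_le q i)) ?qr.
Qed.

Lemma Gdif_rinv phi : Gdif P A phi ->
  exists2 psi, Gdif P A psi & series_comp phi psi = monomial A (id_elt P).
Proof.
set e := monomial A (id_elt P) => -[f f_bar <-].
pose T psi := e - series_comp f psi.
(* Where [f p] is nonzero, the arguments have order strictly below that of [r], so [T] extends
   agreement by one order. *)
have contract psi psi' n :
    (forall r, (op_order r < n)%N -> psi r = psi' r) ->
    forall r, (op_order r < n.+1)%N -> T psi r = T psi' r.
  move=> eqpsi r rn; rewrite /T !fctE; congr (_ - _).
  apply: eq_series_comp => p q qr.
  have [->|/f_bar p2] := eqVneq (f p) 0; first by rewrite !mul0r.
  congr (_ * _); apply: eq_bigr => i _; apply: eqpsi.
  by rewrite (leq_trans (order_arg_lt q i p2)) // qr.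
(* Any two series agree below order 0, so after [n] applications of [T] the images of [iter m T e]
   and [e] agree below order [n]. *)
have iterT n m r : (op_order r < n)%N -> iter (n + m) T e r = iter n T e r.
  elim: n r => // n IH r rn; rewrite addSn !iterS; exact: (contract _ _ n).
(* The limit of the iterates: the coefficient at [r] is stationary from the iterate $|r|+1$ on. *)
pose psi r := iter (op_order r).+1 T e r.
have psiE n r : (op_order r < n)%N -> psi r = iter n T e r.
  by move=> rn; rewrite -(subnKC rn) iterT.
have psi_fix : T psi = psi.
  apply/funext => r; rewrite [RHS](@psiE (op_order r).+1) // iterS.
  apply: (contract _ _ (op_order r)) => // s; exact: psiE.
exists psi.
  apply/GdifP => r r1; rewrite -psi_fix /T !fctE.
  suff -> : series_comp f psi r = 0 by rewrite subr0.
  apply: fsbig1 => p _; apply: fsbig1 => q qr.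
  have [->|/f_bar] := eqVneq (f p) 0; first by rewrite mul0r.
  by rewrite leqNgt (leq_ltn_trans (order_op_le q)) // qr.
(* Additivity on the left gives $(e+f)\circ\psi=\psi+f\circ\psi$, which is $e$ by the fixed-point
   equation. *)
by rewrite series_compDl series_comp1l -{1}psi_fix subrK.
Qed.

End Composition.

Theorem theorem2p1 (P : operad) (A : comPzRingType)
    (iota : {rmorphism rat -> A}) :
  is_group (Gdif P A) (@series_comp P A) (monomial A (id_elt P)) /\
  (forall (p : elements P) (q : 'I_(op_order p) -> elements P),
     op_deg (gamma q) = op_deg p + \sum_(i < op_order p) op_deg (q i)).
Proof.
split; last exact: gamma_deg.
split.
- exact: Gdif_comp.
- by move=> phi psi chi _ _ _; exact: series_compA.
- exact: Gdif1.
- by move=> phi _; rewrite series_comp1l series_comp1r.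
move=> phi /Gdif_rinv [psi psiG phipsi].
(* A right inverse [chi] of [psi] satisfies
   $\chi=(\varphi\circ\psi)\circ\chi=\varphi\circ(\psi\circ\chi)=\varphi$. *)
have [chi _ psichi] := Gdif_rinv psiG.
suff chiphi : chi = phi by exists psi; rewrite chiphi in psichi.
by rewrite -(series_comp1l chi) -phipsi -series_compA psichi series_comp1r.
Qed.
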